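(* Let $M$ be an $H_v$-module over an $H_v$-ring $R$ and let $A=(\mu_A,\lambda_A)$ be an intuitionistic fuzzy set in $M$ such that, for all $t\in[0,1]$, each of the level sets $U(\mu_A;t)=\{x\in M\mid\mu_A(x)\ge t\}$ and $L(\lambda_A;t)=\{x\in M\mid\lambda_A(x)\le t\}$ that is non-empty is an $H_v$-submodule of $M$. Then $A$ is an intuitionistic fuzzy $H_v$-submodule of $M$.
   Context: Hyperoperations. For a non-empty set $H$, $\mathcal P^*(H)$ is the set of non-empty subsets of $H$; a hyperoperation on $H$ is a map $*:H\times H\to\mathcal P^*(H)$. For subsets $A,B\subseteq H$ put $A*B=\bigcup_{a\in A,b\in B}a*b$, and $x*B=\{x\}*B$, $A*x=A*\{x\}$ (likewise for external hyperoperations $R\times M\to\mathcal P^*(M)$). $(H,* )$ is an $H_v$-semigroup if $(x*(y*z))\cap((x*y)*z)\neq\emptyset$ for all $x,y,z\in H$; it is an $H_v$-group if moreover $a*H=H*a=H$ for all $a\in H$. It is weak commutative if $(x*y)\cap(y*x)\ne\emptyset$ for all $x,y$. An $H_v$-ring is a set $R$ with hyperoperations $+,\cdot$ such that $(R,+)$ is an $H_v$-group, $(R,\cdot)$ is an $H_v$-semigroup, and $(x\cdot(y+z))\cap(x\cdot y+x\cdot z)\neq\emptyset$, $((x+y)\cdot z)\cap(x\cdot z+y\cdot z)\ne\emptyset$ for all $x,y,z\in R$. An $H_v$-module over an $H_v$-ring $R$ is a non-empty set $M$ with a hyperoperation $+$ making $(M,+)$ a weak commutative $H_v$-group and a map $\cdot:R\times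 M\to\mathcal P^*(M)$ such that for all $a,b\in R$, $x,y\in M$: $(a\cdot(x+y))\cap(a\cdot x+a\cdot y)\ne\emptyset$, $((a+b)\cdot x)\cap(a\cdot x+b\cdot x)\neq\emptyset$, $((ab)\cdot x)\cap(a\cdot(b\cdot x))\ne\emptyset$. A non-empty subset $S\subseteq M$ is an $H_v$-submodule of $M$ if $(S,+)$ is an $H_v$-subgroup of $(M,+)$, i.e. $a+S=S+a=S$ for all $a\in S$, and $R\cdot S\subseteq S$. Fuzzy sets. A fuzzy set in $X$ is a map $\mu:X\to[0,1]$. An intuitionistic fuzzy set in $X$ is a pair $A=(\mu_A,\lambda_A)$ of fuzzy sets in $X$ with $0\le\mu_A(x)+\lambda_A(x)\le1$ for all $x\in X$. An intuitionistic fuzzy set $A=(\mu_A,\lambda_A)$ in $M$ is an intuitionistic fuzzy $H_v$-submodule of $M$ if: (1) $\min\{\mu_A(x),\mu_A(y)\}\le\inf\{\mu_A(z)\mid z\in x+y\}$ for all $x,y\in M$; (2) for all $x,a\in M$ there exist $y,z\in M$ with $x\in(a+y)\cap(z+a)$ and $\min\{\mu_A(a),\mu_A(x)\}\le\min\{\mu_A(y),\mu_A(z)\}$; (3) $\mu_A(x)\le\inf\{\mu_A(z)\mid z\in r\cdot x\}$ for all $x\in M$, $r\in R$; (4) $\sup\{\lambda_A(z)\mid z\in x+y\}\le\max\{\lambda_A(x),\lambda_A(y)\}$ for all $x,y\in M$; (5) for all $x,a\in M$ there exist $y,z\in M$ with $x\in(a+y)\cap(z+a)$ and $\max\{\lambda_A(y),\lambda_A(z)\}\le\max\{\lambda_A(a),\lambda_A(x)\}$;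 (6) $\sup\{\lambda_A(z)\mid z\in r\cdot x\}\le\lambda_A(x)$ for all $x\in M$, $r\in R$. *)

(* Defs.v *)
From HB Require Import structures.
From mathcomp Require Import all_boot all_order all_algebra.
From mathcomp Require Import all_classical all_reals.

Set Implicit Arguments.
Unset Strict Implicit.
Unset Printing Implicit Defensive.

Import Order.TTheory GRing.Theory Num.Theory.
Local Open Scope classical_set_scope.
Local Open Scope ring_scope.

Record hyperop (X Y Z : Type) := Hyperop {
  hop :> X -> Y -> set Z;
  hop_nonempty : forall x y, hop x y !=set0 }.

Definition hop_set (X Y Z : Type) (op : hyperop X Y Z) (A : set X) (B : set Y)
    : set Z :=
  \bigcup_(a in A) \bigcup_(b in B) op a b.

Definition Hv_semigroup (H : Type) (op : hyperop H H H) : Prop :=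
  forall x y z : H,
    hop_set op [set x] (op y z) `&` hop_set op (op x y) [set z] !=set0.

Definition Hv_group (H : Type) (op : hyperop H H H) : Prop :=
  Hv_semigroup op /\
  forall a : H, hop_set op [set a] setT = setT /\ hop_set op setT [set a] = setT.

Definition weak_commutative (H : Type) (op : hyperop H H H) : Prop :=
  forall x y : H, op x y `&` op y x !=set0.

Record HvRing := {
  ring_carrier :> Type;
  ring_nonempty : inhabited ring_carrier;
  radd : hyperop ring_carrier ring_carrier ring_carrier;
  rmul : hyperop ring_carrier ring_carrier ring_carrier;
  radd_group : Hv_group radd;
  rmul_semigroup : Hv_semigroup rmul;
  rmul_addr : forall x y z : ring_carrier,
    hop_set rmul [set x] (radd y z) `&` hop_set radd (rmul x y) (rmul x z)
      !=set0;
  rmul_addl : forall x y z : ring_carrier,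
    hop_set rmul (radd x y) [set z] `&` hop_set radd (rmul x z) (rmul y z)
      !=set0 }.

Record HvModule (R : HvRing) := {
  module_carrier :> Type;
  module_nonempty : inhabited module_carrier;
  madd : hyperop module_carrier module_carrier module_carrier;
  mscale : hyperop R module_carrier module_carrier;
  madd_group : Hv_group madd;
  madd_weak_commutative : weak_commutative madd;
  mscale_addr : forall (a : R) (x y : module_carrier),
    hop_set mscale [set a] (madd x y) `&` hop_set madd (mscale a x) (mscale a y)
      !=set0;
  mscale_addl : forall (a b : R) (x : module_carrier),
    hop_set mscale (radd R a b) [set x] `&` hop_set madd (mscale a x) (mscale b x)
      !=set0;
  mscale_mul : forall (a b : R) (x : module_carrier),
    hop_set mscale (rmul R a b) [set x] `&` hop_set mscale [set a] (mscale b x)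
      !=set0 }.

Definition Hv_subgroup (H : Type) (op : hyperop H H H) (S : set H) : Prop :=
  forall a, S a -> hop_set op [set a] S = S /\ hop_set op S [set a] = S.

Definition Hv_submodule (R : HvRing) (M : HvModule R) (S : set M) : Prop :=
  [/\ S !=set0, Hv_subgroup (madd M) S & hop_set (mscale M) setT S `<=` S].

Record fuzzy_set (K : realType) (X : Type) := FuzzySet {
  degree :> X -> K;
  degree_itv : forall x, 0 <= degree x <= 1 }.

Record intuitionistic_fuzzy_set (K : realType) (X : Type) :=
  IntuitionisticFuzzySet {
    membership : fuzzy_set K X;
    nonmembership : fuzzy_set K X;
    ifs_sum : forall x, 0 <= membership x + nonmembership x <= 1 }.

Definition upper_level (K : realType) (X : Type) (mu : fuzzy_set K X) (t : K)
    : set X :=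
  [set x | t <= mu x].

Definition lower_level (K : realType) (X : Type) (la : fuzzy_set K X) (t : K)
    : set X :=
  [set x | la x <= t].

(* The real [inf] and [sup] below are the true ones: values of hyperoperations
   are non-empty and degrees lie in [0, 1]. *)
Record intuitionistic_fuzzy_Hv_submodule (K : realType) (R : HvRing)
    (M : HvModule R) (A : intuitionistic_fuzzy_set K M) : Prop := {
  ifs_mu_add : forall x y : M,
    Num.min (membership A x) (membership A y)
      <= inf [set membership A z | z in madd M x y];
  ifs_mu_solve : forall x a : M, exists y z : M,
    (madd M a y `&` madd M z a) x /\
    Num.min (membership A a) (membership A x)
      <= Num.min (membership A y) (membership A z);
  ifs_mu_scale : forall (x : M) (r : R),
    membership A x <= inf [set membership A z | z in mscale M r x];
  ifs_la_add : forall x y : M,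
    sup [set nonmembership A z | z in madd M x y]
      <= Num.max (nonmembership A x) (nonmembership A y);
  ifs_la_solve : forall x a : M, exists y z : M,
    (madd M a y `&` madd M z a) x /\
    Num.max (nonmembership A y) (nonmembership A z)
      <= Num.max (nonmembership A a) (nonmembership A x);
  ifs_la_scale : forall (x : M) (r : R),
    sup [set nonmembership A z | z in mscale M r x] <= nonmembership A x }.

(* Main.v *)
Require Import Defs.
From HB Require Import structures.
From mathcomp Require Import all_boot all_order all_algebra.
From mathcomp Require Import all_classical all_reals.

Set Implicit Arguments.
Unset Strict Implicit.
Unset Printing Implicit Defensive.

Import Order.TTheory.
Local Open Scope classical_set_scope.
Local Open Scope ring_scope.

(** The level set of [mu] at height [min (mu x) (mu y)] contains [x] and [y],
    and this height is attained because degrees are totally ordered; hence each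
    closure property of that level set is one of the fuzzy inequalities. The
    conditions on [lambda] are those on [mu] for the reversed order on degrees,
    so the argument is carried out for degrees in an arbitrary chain. *)

Lemma hop_sub_hop_set (X Y Z : Type) (op : hyperop X Y Z) (A : set X)
    (B : set Y) (x : X) (y : Y) :
  A x -> B y -> op x y `<=` hop_set op A B.
Proof. by move=> Ax By z xyz; exists x => //; exists y. Qed.

Lemma Hv_subgroup_closed (H : Type) (op : hyperop H H H) (S : set H) (x y : H) :
  Hv_subgroup op S -> S x -> S y -> op x y `<=` S.
Proof.
move=> subgroupS Sx Sy; have [xS_eq _] := subgroupS x Sx.
by rewrite -[X in _ `<=` X]xS_eq; exact: hop_sub_hop_set.
Qed.

Lemma Hv_subgroup_solvable (H : Type) (op : hyperop H H H) (S : set H)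
    (a x : H) :
  Hv_subgroup op S -> S a -> S x ->
  exists y z, [/\ S y, S z & (op a y `&` op z a) x].
Proof.
move=> subgroupS Sa Sx; have [aS_eq Sa_eq] := subgroupS a Sa.
have [_ -> [y Sy ayx]] : hop_set op [set a] S x by rewrite aS_eq.
have [z Sz [_ -> zax]] : hop_set op S [set a] x by rewrite Sa_eq.
by exists y, z.
Qed.

Lemma Hv_submodule_scale_closed (R : HvRing) (M : HvModule R) (S : set M)
    (r : R) (x : M) :
  Hv_submodule S -> S x -> mscale M r x `<=` S.
Proof.
by move=> [_ _ RS_sub] Sx; apply: subset_trans RS_sub; exact: hop_sub_hop_set.
Qed.

Section SuperlevelSets.
Context {d : Order.disp_t} {T : orderType d}.

Definition superlevel (X : Type) (f : X -> T) (t : T) : set X :=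
  [set x | t <= f x]%O.

Lemma superlevel_min (X : Type) (f : X -> T) (P : set X -> Prop) :
  (forall x, P (superlevel f (f x))) ->
  forall x y, P (superlevel f (Order.min (f x) (f y))).
Proof. by move=> Pf x y; case: leP. Qed.

Lemma superlevel_minl (X : Type) (f : X -> T) (x y : X) :
  superlevel f (Order.min (f x) (f y)) x.
Proof. by rewrite /superlevel /= ge_min lexx. Qed.

Lemma superlevel_minr (X : Type) (f : X -> T) (x y : X) :
  superlevel f (Order.min (f x) (f y)) y.
Proof. by rewrite /superlevel /= ge_min lexx orbT. Qed.

Record chain_fuzzy_Hv_submodule (R : HvRing) (M : HvModule R) (f : M -> T) :
    Prop := {
  chain_fuzzy_add : forall x y z : M,
    madd M x y z -> (Order.min (f x) (f y) <= f z)%O;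
  chain_fuzzy_solve : forall x a : M, exists y z : M,
    (madd M a y `&` madd M z a) x /\
    (Order.min (f a) (f x) <= Order.min (f y) (f z))%O;
  chain_fuzzy_scale : forall (r : R) (x z : M),
    mscale M r x z -> (f x <= f z)%O }.

Lemma superlevel_chain_fuzzy_Hv_submodule (R : HvRing) (M : HvModule R)
    (f : M -> T) :
  (forall x, Hv_submodule (superlevel f (f x))) -> chain_fuzzy_Hv_submodule f.
Proof.
move=> submod_level; have submod_min := superlevel_min submod_level.
split=> [x y z|x a|r x z].
- have [_ subgroup_min _] := submod_min x y.
  exact: Hv_subgroup_closed subgroup_min
    (superlevel_minl f x y) (superlevel_minr f x y) z.
- have [_ subgroup_min _] := submod_min a x.
  have [y [z [ley lez ayzax]]] := Hv_subgroup_solvable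
    subgroup_min (superlevel_minl f a x) (superlevel_minr f a x).
  by exists y, z; split; rewrite // le_min; apply/andP.
- exact: Hv_submodule_scale_closed (submod_level x) (lexx (f x)) z.
Qed.

End SuperlevelSets.

Section ImageBounds.
Context {K : realType} {X : Type}.
Implicit Types (f : X -> K) (S : set X) (t : K).

Lemma lb_le_inf_image f S t :
  S !=set0 -> (forall x, S x -> t <= f x) -> t <= inf [set f x | x in S].
Proof.
by move=> S0 le_t; apply: lb_le_inf (image_nonempty f S0) _ => _ [x /le_t ? <-].
Qed.

Lemma ge_sup_image f S t :
  S !=set0 -> (forall x, S x -> f x <= t) -> sup [set f x | x in S] <= t.
Proof.
by move=> S0 ge_t; apply: ge_sup (image_nonempty f S0) _ => _ [x /ge_t ? <-].
Qed.

End ImageBounds.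

Theorem theorem4p8 (K : realType) (R : HvRing) (M : HvModule R)
    (A : intuitionistic_fuzzy_set K M)
    (hlevel : forall t : K, 0 <= t <= 1 ->
      (upper_level (membership A) t !=set0 ->
        Hv_submodule (upper_level (membership A) t)) /\
      (lower_level (nonmembership A) t !=set0 ->
        Hv_submodule (lower_level (nonmembership A) t))) :
  intuitionistic_fuzzy_Hv_submodule A.
Proof.
have [mu_add mu_solve mu_scale] : chain_fuzzy_Hv_submodule (membership A).
  apply: superlevel_chain_fuzzy_Hv_submodule => x.
  by apply: (hlevel _ (degree_itv _ x)).1; exists x; exact: lexx.
have [la_add la_solve la_scale] :
    chain_fuzzy_Hv_submodule (nonmembership A : M -> K^d).
  apply: superlevel_chain_fuzzy_Hv_submodule => x.
  by apply: (hlevel _ (degree_itv _ x)).2; exists x; exact: lexx.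
(* The minimum in [K^d] unfolds to the maximum in [K] with swapped arguments. *)
split=> [x y|//|x r|x y|x a|x r].
- by apply: lb_le_inf_image => [|z /mu_add]; first exact: hop_nonempty.
- by apply: lb_le_inf_image => [|z /mu_scale]; first exact: hop_nonempty.
- rewrite maxC.
  by apply: ge_sup_image => [|z /la_add]; first exact: hop_nonempty.
- have [y [z [xP le_max]]] := la_solve x a; exists y, z; split=> //.
  by rewrite [leLHS]maxC [leRHS]maxC.
- by apply: ge_sup_image => [|z /la_scale]; first exact: hop_nonempty.
Qed.
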